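(* Let $R$ be a commutative noetherian ring, let $C$ be a semidualizing $R$-module, and assume that $M$ and $N$ are finitely generated $R$-modules. For all $i$ the modules $\operatorname{Tor}^{\mathcal{P}_C\mathcal{M}}_i(M,N)$ and $\operatorname{Tor}^{\mathcal{F}_C\mathcal{M}}_i(M,N)$ are finitely generated over $R$.
   Context: $R$ is a commutative noetherian ring. A finitely generated $R$-module $C$ is semidualizing if the homothety map $R\to\operatorname{Hom}_R(C,C)$ is an isomorphism and $\operatorname{Ext}^i_R(C,C)=0$ for all $i\geq 1$. $\mathcal{P}_C(R)$ is the class of $R$-modules isomorphic to $P\otimes_R C$ with $P$ projective, and $\mathcal{F}_C(R)$ is the class of $R$-modules isomorphic to $F\otimes_R C$ with $F$ flat; both are precovering. For a precovering class $\mathcal{X}$, a proper $\mathcal{X}$-resolution of $M$ is a complex $X=(\cdots\to X_1\to X_0\to 0)$ with each $X_i\in\mathcal{X}$ together with an augmentation $X_0\to M$ such that $X^+=(\cdots\to X_1\to X_0\to M\to 0)$ is a complex (not necessarily exact) and $\operatorname{Hom}_R(Y,X^+)$ is exact for all $Y\in\mathcal{X}$. If $Q$ is a proper $\mathcal{P}_C$-resolution of $M$ and $G$ is a proper $\mathcal{F}_C$-resolution of $M$, then for $i\geq 0$ $$\operatorname{Tor}^{\mathcal{P}_C\mathcal{M}}_i(M,N):=H_i(Q\otimes_R N),\qquad \operatorname{Tor}^{\mathcal{F}_C\mathcal{M}}_i(M,N):=H_i(G\otimes_R N),$$ independent of the choice of proper resolutions. *)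

(* Defs.v *)
From HB Require Import structures.
From mathcomp Require Import all_boot all_order all_algebra.
From mathcomp Require Import boolp.

Set Implicit Arguments.
Unset Strict Implicit.
Unset Printing Implicit Defensive.

Import GRing.Theory.
Local Open Scope ring_scope.
Local Open Scope quotient_scope.

(* Rings are [comPzRingType]s: the zero ring is allowed. *)

Definition fin_gen (R : comPzRingType) (V : lmodType R) : Prop :=
  exists (n : nat) (g : 'I_n -> V),
    forall v : V, exists a : 'I_n -> R, v = \sum_(i < n) a i *: g i.

(* Ideals need not be proper, unlike mathcomp's [idealr]. *)
Definition is_ideal (R : comPzRingType) (I : R -> Prop) : Prop :=
  I 0 /\ forall a x y : R, I x -> I y -> I (a * x + y).

Definition noetherian (R : comPzRingType) : Prop :=
  forall I : R -> Prop, is_ideal I ->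
  exists (n : nat) (g : 'I_n -> R),
    (forall i, I (g i)) /\
    (forall x, I x -> exists a : 'I_n -> R, x = \sum_(i < n) a i * g i).

Section HomModule.
Variables (R : comPzRingType) (U V : lmodType R).
Local Notation H := {linear U -> V}.

Lemma linear_ext (f g : H) : f =1 g -> f = g.
Proof.
case: f => f [[af] [sf]]; case: g => g [[ag] [sg]] /= /funext fg.
case: _ / fg in ag sg *.
by rewrite (Prop_irrelevance af ag) (Prop_irrelevance sf sg).
Qed.

HB.instance Definition _ := gen_eqMixin H.
HB.instance Definition _ := gen_choiceMixin H.

Definition hom_zero : H := \0.
Definition hom_opp (f : H) : H := \- f.
Definition hom_add (f g : H) : H := f \+ g.
Definition hom_scale (a : R) (f : H) : H := a \*: f.

Fact hom_addA : associative hom_add.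
Proof. by move=> f g h; apply: linear_ext => x /=; rewrite addrA. Qed.
Fact hom_addC : commutative hom_add.
Proof. by move=> f g; apply: linear_ext => x /=; rewrite addrC. Qed.
Fact hom_add0 : left_id hom_zero hom_add.
Proof. by move=> f; apply: linear_ext => x /=; rewrite add0r. Qed.
Fact hom_addN : left_inverse hom_zero hom_opp hom_add.
Proof. by move=> f; apply: linear_ext => x /=; rewrite addNr. Qed.
HB.instance Definition _ :=
  GRing.isZmodule.Build H hom_addA hom_addC hom_add0 hom_addN.

Fact hom_scaleA a b f : hom_scale a (hom_scale b f) = hom_scale (a * b) f.
Proof. by apply: linear_ext => x /=; rewrite scalerA. Qed.
Fact hom_scale1 : left_id 1 hom_scale.
Proof. by move=> f; apply: linear_ext => x /=; rewrite scale1r. Qed.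
Fact hom_scaleDr : right_distributive hom_scale +%R.
Proof. by move=> a f g; apply: linear_ext => x /=; rewrite scalerDr. Qed.
Fact hom_scaleDl f : {morph hom_scale^~ f : a b / a + b}.
Proof. by move=> a b; apply: linear_ext => x /=; rewrite scalerDl. Qed.
HB.instance Definition _ := GRing.Zmodule_isLmodule.Build R H
  hom_scaleA hom_scale1 hom_scaleDr hom_scaleDl.

Definition hom_mod : lmodType R := H.

End HomModule.

Section HomFunctor.
Variables (R : comPzRingType) (U V W : lmodType R).

Definition hom_post (g : {linear V -> W}) (f : hom_mod U V) : hom_mod U W :=
  g \o f.

Fact hom_post_linear g : linear (hom_post g).
Proof. by move=> a f h; apply: linear_ext => x /=; rewrite linearP. Qed.
HB.instance Definition _ g :=
  GRing.isLinear.Build R (hom_mod U V) (hom_mod U W) _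
    (hom_post g) (hom_post_linear g).

Definition hom_pre (g : {linear U -> V}) (f : hom_mod V W) : hom_mod U W :=
  f \o g.

Fact hom_pre_linear g : linear (hom_pre g).
Proof. by move=> a f h; apply: linear_ext. Qed.
HB.instance Definition _ g :=
  GRing.isLinear.Build R (hom_mod V W) (hom_mod U W) _
    (hom_pre g) (hom_pre_linear g).

End HomFunctor.

Definition homothety (R : comPzRingType) (C : lmodType R) (r : R) :
    hom_mod C C :=
  r \*: idfun.

Section QuotientModule.
Variables (R : comPzRingType) (V : lmodType R) (S : submodClosed V).

(* [submodClosed] lives over semimodules and carries no closure under opposite;
   over a ring the latter is automatic, but has to be declared. *)
Definition submod_pred : {pred V} := S.
Fact submod_predP : subsemimod_closed submod_pred.
Proof. by split; [split; [exact: rpred0 | exact: rpredD] | exact: rpredZ]. Qed.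
HB.instance Definition _ :=
  GRing.isSubmodClosed.Build R V submod_pred submod_predP.

Definition quot_mod := Quotient.quot submod_pred.
HB.instance Definition _ := GRing.Zmodule.on quot_mod.

Definition quot_cl (v : V) : quot_mod := \pi_(Quotient.quot submod_pred) v.

Definition qscale (a : R) (x : quot_mod) : quot_mod := quot_cl (a *: repr x).

Fact quot_clP u v : quot_cl u = quot_cl v <-> u - v \in S.
Proof.
by rewrite -[_ \in S]/(_ \in submod_pred) Quotient.idealrBE; split=> /eqP.
Qed.

Fact quot_clK x : quot_cl (repr x) = x.
Proof. exact: reprK. Qed.

Fact quot_clD u v : quot_cl (u + v) = quot_cl u + quot_cl v.
Proof. exact: raddfD. Qed.

Fact qscaleE a v : qscale a (quot_cl v) = quot_cl (a *: v).
Proof.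
by apply/quot_clP; rewrite -scalerBr rpredZ //; apply/quot_clP/quot_clK.
Qed.

Fact qscaleA a b x : qscale a (qscale b x) = qscale (a * b) x.
Proof. by rewrite -[x]quot_clK !qscaleE scalerA. Qed.
Fact qscale1 : left_id 1 qscale.
Proof. by move=> x; rewrite -[x]quot_clK qscaleE scale1r. Qed.
Fact qscaleDr : right_distributive qscale +%R.
Proof.
move=> a x y; rewrite -[x]quot_clK -[y]quot_clK.
by rewrite -quot_clD !qscaleE scalerDr quot_clD.
Qed.
Fact qscaleDl x : {morph qscale^~ x : a b / a + b}.
Proof. by move=> a b; rewrite -[x]quot_clK !qscaleE scalerDl quot_clD. Qed.
HB.instance Definition _ := GRing.Zmodule_isLmodule.Build R quot_mod
  qscaleA qscale1 qscaleDr qscaleDl.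

End QuotientModule.

Section Homology.
Variables (R : comPzRingType) (U V W : lmodType R).
Variables (f : {linear U -> V}) (g : {linear V -> W}).

Definition in_ker : {pred V} := [pred x | g x == 0].

Fact in_ker_submod : subsemimod_closed in_ker.
Proof.
split; first split.
- by rewrite inE linear0.
- by move=> x y; rewrite !inE => /eqP gx /eqP gy; rewrite linearD gx gy addr0.
by move=> a x; rewrite !inE => /eqP gx; rewrite linearZ /= gx scaler0.
Qed.
HB.instance Definition _ := GRing.isSubmodClosed.Build R V in_ker in_ker_submod.

Definition ker_mod := {x : V | in_ker x}.
HB.instance Definition _ := SubChoice.on ker_mod.
HB.instance Definition _ := [SubChoice_isSubLmodule of ker_mod by <:].

Definition in_im : {pred ker_mod} :=
  [pred z : ker_mod | `[< exists u : U, f u = val z >]].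

Fact in_im_submod : subsemimod_closed in_im.
Proof.
split; first split.
- by rewrite inE; apply/asboolP; exists 0; rewrite linear0 raddf0.
- move=> x y; rewrite !inE => /asboolP[u ux] /asboolP[v vy].
  by apply/asboolP; exists (u + v); rewrite linearD ux vy raddfD.
move=> a x; rewrite !inE => /asboolP[u ux].
by apply/asboolP; exists (a *: u); rewrite linearZ /= ux.
Qed.
HB.instance Definition _ :=
  GRing.isSubmodClosed.Build R ker_mod in_im in_im_submod.

(* ker g / (im f meet ker g), i.e. ker g / im f as soon as g \o f = 0. *)
Definition homology : lmodType R := quot_mod in_im.

End Homology.

Section Tensor.
Variables (R : comPzRingType) (M N : lmodType R).

(* Formal sums of pairs, modulo the least additive congruence making
   (m, n) |-> [:: (m, n)] R-balanced and additive in each variable.  No formal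
   opposites are needed: (- m) (x) n is the opposite of m (x) n. *)
Inductive tens_eq : seq (M * N) -> seq (M * N) -> Prop :=
| TensRefl s : tens_eq s s
| TensSym s t : tens_eq s t -> tens_eq t s
| TensTrans s t u : tens_eq s t -> tens_eq t u -> tens_eq s u
| TensCat s s' t t' :
    tens_eq s s' -> tens_eq t t' -> tens_eq (s ++ t) (s' ++ t')
| TensCatC s t : tens_eq (s ++ t) (t ++ s)
| TensDl m m' n : tens_eq [:: (m + m', n)] [:: (m, n); (m', n)]
| TensDr m n n' : tens_eq [:: (m, n + n')] [:: (m, n); (m, n')]
| TensZ (a : R) m n : tens_eq [:: (a *: m, n)] [:: (m, a *: n)]
| Tens0 n : tens_eq [:: (0, n)] [::].

Definition tens_eqb : rel (seq (M * N)) := [rel s t | `[< tens_eq s t >]].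

Fact tens_eqb_equiv : equiv_class_of tens_eqb.
Proof.
split=> [s|s t|t s u].
- exact/asboolP/TensRefl.
- by apply/asboolP/asboolP => /TensSym.
- by move=> /asboolP st /asboolP tu; apply/asboolP/(TensTrans st).
Qed.
Canonical tens_eqb_equiv_rel := EquivRelPack tens_eqb_equiv.
Canonical tens_eqb_encModRel := defaultEncModRel tens_eqb.

Definition tens := {eq_quot tens_eqb}.
HB.instance Definition _ := Choice.on tens.

Definition tens_cl (s : seq (M * N)) : tens := \pi_({eq_quot tens_eqb}) s.

Fact tens_clP s t : tens_cl s = tens_cl t <-> tens_eq s t.
Proof.
split=> [/eqP|st]; first by rewrite piE => /asboolP.
by apply/eqP; rewrite piE; apply/asboolP.
Qed.

Fact tens_reprK (t : tens) : tens_cl (repr t) = t.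
Proof. exact: reprK. Qed.

Fact tens_repr_cl s : tens_eq (repr (tens_cl s)) s.
Proof. by apply/tens_clP; rewrite tens_reprK. Qed.

Definition scale_sum (a : R) : seq (M * N) -> seq (M * N) :=
  map (fun p => (a *: p.1, p.2)).

Fact scale_sum_eq a s t :
  tens_eq s t -> tens_eq (scale_sum a s) (scale_sum a t).
Proof.
elim=> {s t} /=.
- by move=> s; apply: TensRefl.
- by move=> s t _; apply: TensSym.
- by move=> s t u _ + _; apply: TensTrans.
- by move=> s s' t t' _ ss' _ tt'; rewrite /scale_sum !map_cat; apply: TensCat.
- by move=> s t; rewrite /scale_sum !map_cat; apply: TensCatC.
- by move=> m m' n; rewrite scalerDr; apply: TensDl.
- by move=> m n n'; apply: TensDr.
- move=> b m n; rewrite scalerA mulrC -scalerA; exact: TensZ.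
- by move=> n; rewrite scaler0; apply: Tens0.
Qed.

Definition tens_zero : tens := tens_cl [::].
Definition tens_add (x y : tens) : tens := tens_cl (repr x ++ repr y).
Definition tens_scale (a : R) (x : tens) : tens :=
  tens_cl (scale_sum a (repr x)).
Definition tens_opp (x : tens) : tens := tens_scale (-1) x.

Fact tens_addE s t : tens_add (tens_cl s) (tens_cl t) = tens_cl (s ++ t).
Proof. by apply/tens_clP; apply: TensCat; apply: tens_repr_cl. Qed.

Fact tens_scaleE a s : tens_scale a (tens_cl s) = tens_cl (scale_sum a s).
Proof. by apply/tens_clP/scale_sum_eq/tens_repr_cl. Qed.

Fact tens_ind (P : tens -> Prop) : (forall s, P (tens_cl s)) -> forall t, P t.
Proof. by move=> Pcl t; rewrite -[t]tens_reprK. Qed.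

Fact tens_addA : associative tens_add.
Proof.
elim/tens_ind=> s; elim/tens_ind=> t; elim/tens_ind=> u.
by rewrite !tens_addE catA.
Qed.
Fact tens_addC : commutative tens_add.
Proof.
elim/tens_ind=> s; elim/tens_ind=> t; rewrite !tens_addE.
exact/tens_clP/TensCatC.
Qed.
Fact tens_add0 : left_id tens_zero tens_add.
Proof. by elim/tens_ind=> s; rewrite tens_addE. Qed.

Fact tens_scaleDl x a b :
  tens_scale (a + b) x = tens_add (tens_scale a x) (tens_scale b x).
Proof.
elim/tens_ind: x => s; rewrite !tens_scaleE tens_addE; apply/tens_clP.
elim: s => [|[m n] s IHs] /=; first exact: TensRefl.
rewrite -[_ :: _]cat1s scalerDl.
apply: TensTrans (TensCat (TensDl _ _ _) IHs) _.
rewrite -[_ ++ (_ ++ _)]/([:: (a *: m, n)] ++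
  ([:: (b *: m, n)] ++ (scale_sum a s ++ scale_sum b s))).
apply: (TensCat (TensRefl [:: (a *: m, n)])).
rewrite !catA -[_ :: scale_sum b s]cat1s catA.
by apply: TensCat (TensRefl _); apply: TensCatC.
Qed.

Fact tens_scale0 x : tens_scale 0 x = tens_zero.
Proof.
elim/tens_ind: x => s; rewrite tens_scaleE; apply/tens_clP.
elim: s => [|[m n] s IHs] /=; first exact: TensRefl.
by rewrite scale0r -[_ :: _]cat1s; apply: TensCat (Tens0 n) IHs.
Qed.

Fact tens_scale1 : left_id 1 tens_scale.
Proof.
elim/tens_ind=> s; rewrite tens_scaleE /scale_sum.
by rewrite (eq_map (g := id)) ?map_id // => -[m n] /=; rewrite scale1r.
Qed.

Fact tens_addN : left_inverse tens_zero tens_opp tens_add.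
Proof.
move=> x; rewrite -[X in tens_add _ X]tens_scale1 /tens_opp.
by rewrite -tens_scaleDl addNr tens_scale0.
Qed.
HB.instance Definition _ :=
  GRing.isZmodule.Build tens tens_addA tens_addC tens_add0 tens_addN.

Fact tens_scaleA a b x : tens_scale a (tens_scale b x) = tens_scale (a * b) x.
Proof.
elim/tens_ind: x => s; rewrite !tens_scaleE /scale_sum -map_comp.
by congr tens_cl; apply: eq_map => -[m n] /=; rewrite scalerA.
Qed.
Fact tens_scaleDr : right_distributive tens_scale +%R.
Proof.
move=> a; elim/tens_ind=> s; elim/tens_ind=> t.
rewrite -[_ + _]/(tens_add _ _) -[RHS]/(tens_add _ _).
by rewrite tens_addE !tens_scaleE tens_addE /scale_sum map_cat.
Qed.
HB.instance Definition _ := GRing.Zmodule_isLmodule.Build R tens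
  tens_scaleA tens_scale1 tens_scaleDr tens_scaleDl.

Definition tensor (m : M) (n : N) : tens := tens_cl [:: (m, n)].

End Tensor.

Arguments tens {R} M N.

Definition bilin (R : comPzRingType) (M N P : lmodType R) (b : M -> N -> P) :
    Prop :=
  (forall n : N, linear (b^~ n)) /\ (forall m : M, linear (b m)).

Section UniversalProperty.
Variables (R : comPzRingType) (M N : lmodType R).

Lemma tensor_bilin : bilin (@tensor R M N).
Proof.
split=> [n a m m'|m a n n']; apply: esym.
  rewrite -[_ + _]/(tens_add (tens_scale a _) _) tens_scaleE tens_addE.
  by apply/tens_clP/TensSym/TensDl.
rewrite -[_ + _]/(tens_add (tens_scale a _) _) tens_scaleE tens_addE /=.
apply/tens_clP; apply: TensSym; apply: TensTrans (TensDr _ _ _) _.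
rewrite -[[:: _; _]]/([:: (m, a *: n)] ++ [:: (m, n')]).
exact: (TensCat (TensSym (TensZ _ _ _)) (TensRefl [:: (m, n')])).
Qed.

Lemma tens_clE s : tens_cl s = \sum_(p <- s) tensor p.1 p.2 :> tens M N.
Proof.
elim: s => [|[m n] s IHs]; first by rewrite big_nil.
by rewrite big_cons -IHs -[RHS]/(tens_add _ _) tens_addE.
Qed.

Variables (P : lmodType R) (b : M -> N -> P) (b_bilin : bilin b).

Definition tens_lift of bilin b := fun t : tens M N =>
  \sum_(p <- repr t) b p.1 p.2.

Fact bilin_sum_eq (s t : seq (M * N)) : tens_eq s t ->
  \sum_(p <- s) b p.1 p.2 = \sum_(p <- t) b p.1 p.2.
Proof.
have [bl br] := b_bilin.
have bDl n : {morph b^~ n : x y / x + y}.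
  by move=> x y; have:= bl n 1 x y; rewrite !scale1r.
have bDr m : {morph b m : x y / x + y}.
  by move=> x y; have:= br m 1 x y; rewrite !scale1r.
have b0l n : b 0 n = 0 by apply: (addIr (b 0 n)); rewrite -bDl !add0r.
have b0r m : b m 0 = 0 by apply: (addIr (b m 0)); rewrite -bDr !add0r.
elim=> {s t} /=.
- by [].
- by move=> s t _ ->.
- by move=> s t u _ -> _ ->.
- by move=> s s' t t' _ ss' _ tt'; rewrite !big_cat ss' tt'.
- by move=> s t; rewrite !big_cat /= addrC.
- by move=> m m' n; rewrite !big_cons !big_nil !addr0 /= bDl.
- by move=> m n n'; rewrite !big_cons !big_nil !addr0 /= bDr.
- move=> a m n; rewrite !big_cons !big_nil !addr0 /=.
  have:= bl n a m 0; have:= br m a n 0.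
  by rewrite b0l b0r !addr0 => -> ->.
- by move=> n; rewrite big_cons big_nil /= b0l addr0.
Qed.

Fact tens_lift_cl s : tens_lift b_bilin (tens_cl s) = \sum_(p <- s) b p.1 p.2.
Proof. exact/bilin_sum_eq/tens_repr_cl. Qed.

Fact tens_lift_linear : linear (tens_lift b_bilin).
Proof.
move=> a; elim/tens_ind=> s; elim/tens_ind=> t.
rewrite -[_ *: _ + _]/(tens_add (tens_scale a _) _) tens_scaleE tens_addE.
rewrite !tens_lift_cl big_cat big_map scaler_sumr /=; congr (_ + _).
apply: eq_bigr => -[m n] _ /=.
have b0 : b 0 n = 0.
  apply: (addIr (b 0 n)); have := b_bilin.1 n 1 0 0.
  by rewrite !scale1r !add0r => <-.
by have := b_bilin.1 n a m 0; rewrite b0 !addr0.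
Qed.
HB.instance Definition _ := GRing.isLinear.Build R (tens M N) P _
  (tens_lift b_bilin) tens_lift_linear.

Lemma tens_liftE m n : tens_lift b_bilin (tensor m n) = b m n.
Proof. by rewrite tens_lift_cl big_seq1. Qed.

Lemma tens_lift_uniq (h : {linear tens M N -> P}) :
  (forall m n, h (tensor m n) = b m n) -> h =1 tens_lift b_bilin.
Proof.
move=> hE; elim/tens_ind=> s; rewrite tens_lift_cl tens_clE linear_sum.
by apply: eq_bigr => p _; apply: hE.
Qed.

End UniversalProperty.

Section TensorMap.
Variables (R : comPzRingType) (M M' N N' : lmodType R).
Variables (f : {linear M -> M'}) (g : {linear N -> N'}).

Fact tens_map_bilin : bilin (fun m n => tensor (f m) (g n)).
Proof.
have [tl tr] := @tensor_bilin R M' N'.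
by split=> [n a m m'|m a n n'] /=; rewrite linearP (tl, tr).
Qed.

Definition tens_map : {linear tens M N -> tens M' N'} :=
  tens_lift tens_map_bilin.

Lemma tens_mapE m n : tens_map (tensor m n) = tensor (f m) (g n).
Proof. exact: tens_liftE. Qed.

End TensorMap.

(* Complexes  ... -> X_1 -> X_0 -> 0. *)
Record complex (R : comPzRingType) := Complex {
  cx_obj :> nat -> lmodType R;
  cx_d : forall i, {linear cx_obj i.+1 -> cx_obj i};
  cx_dd : forall i x, cx_d i (cx_d i.+1 x) = 0
}.

(* The differential leaving degree i; in degree 0 its codomain should be the
   zero module, which we replace by the zero endomorphism of X_0. *)
Definition cx_out (R : comPzRingType) (X : complex R) (i : nat) :
    {linear X i -> X i.-1} :=
  match i with 0 => \0 | j.+1 => cx_d X j end.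

Definition cx_homology (R : comPzRingType) (X : complex R) (i : nat) :
    lmodType R :=
  homology (cx_d X i) (cx_out X i).

Definition cx_exact (R : comPzRingType) (X : complex R) : Prop :=
  forall (i : nat) (x : X i), cx_out X i x = 0 -> exists y, cx_d X i y = x.

Section TensorComplex.
Variables (R : comPzRingType) (X : complex R) (N : lmodType R).

Definition tens_cx_d i : {linear tens (X i.+1) N -> tens (X i) N} :=
  tens_map (cx_d X i) idfun.

Fact tens_cx_dd i x : tens_cx_d i (tens_cx_d i.+1 x) = 0.
Proof.
elim/tens_ind: x => s; rewrite tens_clE !linear_sum big1 // => p _.
rewrite /tens_cx_d !tens_mapE cx_dd.
have := (@tensor_bilin R (X i) N).1 (idfun (idfun p.2)) (-1) 0 0.
by rewrite scaler0 addr0 scaleN1r addNr.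
Qed.

Definition tens_complex : complex R := Complex tens_cx_dd.

End TensorComplex.

Section HomComplex.
Variables (R : comPzRingType) (Y : lmodType R) (X : complex R).

Definition hom_cx_d i : {linear hom_mod Y (X i.+1) -> hom_mod Y (X i)} :=
  hom_post (cx_d X i).

Fact hom_cx_dd i x : hom_cx_d i (hom_cx_d i.+1 x) = 0.
Proof. by apply: linear_ext => y /=; rewrite cx_dd. Qed.

Definition hom_complex : complex R := Complex hom_cx_dd.

End HomComplex.

Section Augmented.
Variables (R : comPzRingType) (X : complex R) (M : lmodType R).
Variables (e : {linear X 0 -> M}) (ed : forall x, e (cx_d X 0 x) = 0).

(* X^+, shifted by one so that M sits in degree 0 and X_i in degree i + 1. *)
Definition aug_obj (i : nat) : lmodType R :=
  match i with 0 => M | j.+1 => X j end.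

Definition aug_d (i : nat) : {linear aug_obj i.+1 -> aug_obj i} :=
  match i with 0 => e | j.+1 => cx_d X j end.

Fact aug_dd i x : aug_d i (aug_d i.+1 x) = 0.
Proof. by case: i x => [|i] x /=; rewrite ?ed ?cx_dd. Qed.

Definition augmented : complex R := Complex aug_dd.

End Augmented.

Section ModuleClasses.
Variable R : comPzRingType.
Implicit Types C P F X : lmodType R.

Definition surj (U V : Type) (f : U -> V) : Prop := forall y, exists x, f x = y.

Definition projective P : Prop :=
  forall (A B : lmodType R) (p : {linear A -> B}) (f : {linear P -> B}),
    surj p -> exists h : {linear P -> A}, forall x, p (h x) = f x.

Definition flat F : Prop :=
  forall (A B : lmodType R) (f : {linear A -> B}),
    injective f -> injective (tens_map (idfun : {linear F -> F}) f).

Definition isomorphic (U V : lmodType R) : Prop :=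
  exists f : {linear U -> V}, bijective f.

Definition in_PC C X : Prop :=
  exists P, projective P /\ isomorphic X (tens P C).

Definition in_FC C X : Prop :=
  exists F, flat F /\ isomorphic X (tens F C).

End ModuleClasses.

Record projective_resolution (R : comPzRingType) (M : lmodType R) :=
  ProjectiveResolution {
    pres_cx :> complex R;
    pres_aug : {linear pres_cx 0 -> M};
    pres_augd : forall x, pres_aug (cx_d pres_cx 0 x) = 0;
    pres_proj : forall i, projective (pres_cx i);
    pres_exact : cx_exact (augmented pres_augd)
  }.

(* The differential of Hom(P, B) entering degree i. *)
Definition ext_in (R : comPzRingType) (P : complex R) (B : lmodType R)
    (i : nat) : {linear hom_mod (P i.-1) B -> hom_mod (P i) B} :=
  match i with 0 => \0 | j.+1 => hom_pre (cx_d P j) end.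

(* Ext^i(M, B), computed from a projective resolution P of M. *)
Definition Ext (R : comPzRingType) (M : lmodType R)
    (P : projective_resolution M) (B : lmodType R) (i : nat) : lmodType R :=
  homology (ext_in P B i) (hom_pre (cx_d P i)).

Record semidualizing (R : comPzRingType) (C : lmodType R) : Prop :=
  Semidualizing {
    sd_fin_gen : fin_gen C;
    sd_homothety : bijective (homothety C);
    sd_ext : forall (P : projective_resolution C) (i : nat),
      (1 <= i)%N -> forall x : Ext P C i, x = 0
  }.

Record proper_resolution (R : comPzRingType) (X : lmodType R -> Prop)
    (M : lmodType R) :=
  ProperResolution {
    prop_cx :> complex R;
    prop_aug : {linear prop_cx 0 -> M};
    prop_augd : forall x, prop_aug (cx_d prop_cx 0 x) = 0;
    prop_mem : forall i, X (prop_cx i);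
    prop_exact : forall Y : lmodType R, X Y ->
      cx_exact (hom_complex Y (augmented prop_augd))
  }.

(* The relative Tor modules are attached to a chosen proper resolution: they
   are independent of that choice only up to isomorphism. *)
Definition Tor_PCM (R : comPzRingType) (C M : lmodType R)
    (Q : proper_resolution (in_PC C) M) (N : lmodType R) (i : nat) :
    lmodType R :=
  cx_homology (tens_complex Q N) i.

Definition Tor_FCM (R : comPzRingType) (C M : lmodType R)
    (G : proper_resolution (in_FC C) M) (N : lmodType R) (i : nat) :
    lmodType R :=
  cx_homology (tens_complex G N) i.

(* Main.v *)
From HB Require Import structures.
From mathcomp Require Import all_boot all_order all_algebra.
From mathcomp Require Import boolp functions.
Require Import Defs.

(** Both relative Tor modules are ordinary Tor modules of finitely generated
    modules. Let [X] be a proper resolution of [M] by modules of the form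
    [F (x) C] with [F] flat; projective modules are flat ([projective_flat]), so
    resolutions in [in_PC C] are of this kind. Since [C = R (x) C] itself lies in
    both classes, properness says in particular that [Hom(C, X)] is an exact
    resolution of [Hom(C, M)].

    The role of the homothety isomorphism [R = Hom(C, C)] is to make the
    functors [Hom(C, -)] and [- (x) C] inverse to each other on flat modules and
    their twists: [x |-> (c |-> x (x) c)] is an isomorphism from [F] to
    [Hom(C, F (x) C)] when [F] is flat ([hom_tens_surj], [hom_tens_inj]). Hence
    each [Hom(C, X_i)] is flat, and evaluation identifies
    [Hom(C, X_i) (x) (C (x) N)] with [X_i (x) N], compatibly with the
    differentials ([in_FC_hom], [hom_ev_natural]). So [X (x) N] has the homology
    of the tensor product of a flat resolution of the finitely generated module
    [Hom(C, M)] with the finitely generated module [C (x) N], which is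
    [Tor_i(Hom(C, M), C (x) N)].

    Finite generation of the latter is proved by dimension shifting in the
    second argument ([fg_homology_tens]). Write a finitely generated [N] as a
    quotient of a finite free module with kernel [K], which is finitely generated
    because [R] is noetherian. Tensoring with a flat complex [F] gives a short
    exact sequence of complexes whose middle term is acyclic in positive
    degrees, so that [H_(n+1)(F (x) N)] embeds in [H_n(F (x) K)]
    ([fg_homology_connecting]), while [H_0(F (x) N)] is generated by the tensors
    of generators. *)

Set Implicit Arguments.
Unset Strict Implicit.
Unset Printing Implicit Defensive.

Import GRing.Theory.
Local Open Scope ring_scope.

Definition linear_of (R : pzRingType) (U V : lmodType R) (f : U -> V)
    (f_lin : linear f) : {linear U -> V} :=
  HB.pack f (GRing.isLinear.Build R U V _ f f_lin).

(** * Finite generation over a noetherian ring *)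

Section Span.
Variables (R : comPzRingType) (V : lmodType R).

Definition submodule (S : V -> Prop) : Prop :=
  S 0 /\ forall (a : R) x y, S x -> S y -> S (a *: x + y).

Definition lincomb (I : finType) (g : I -> V) (v : V) : Prop :=
  exists a : I -> R, v = \sum_i a i *: g i.

Lemma submodule_sum (S : V -> Prop) (I : finType) (a : I -> R) (g : I -> V) :
  submodule S -> (forall i, S (g i)) -> S (\sum_i a i *: g i).
Proof.
move=> [S0 Sl] Sg; elim/big_ind: _ => // [x y Sx Sy|i _].
  by rewrite -[x]scale1r; apply: Sl.
by rewrite -[_ *: _]addr0; apply: Sl.
Qed.

Lemma lincomb_min (S : V -> Prop) (I : finType) (g : I -> V) v :
  submodule S -> (forall i, S (g i)) -> lincomb g v -> S v.
Proof. by move=> subS Sg [a ->]; apply: submodule_sum. Qed.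

Lemma lincomb_submodule (I : finType) (g : I -> V) : submodule (lincomb g).
Proof.
split=> [|a x y [b ->] [c ->]].
  by exists (fun=> 0); rewrite big1 // => i _; rewrite scale0r.
exists (fun i => a * b i + c i); rewrite scaler_sumr -big_split /=.
by apply: eq_bigr => i _; rewrite scalerDl scalerA.
Qed.

Lemma lincomb_gen (I : finType) (g : I -> V) i : lincomb g (g i).
Proof.
exists (fun j => (j == i)%:R).
rewrite (bigD1 i) //= eqxx scale1r big1 ?addr0 // => j /negPf->.
by rewrite scale0r.
Qed.

Lemma lincomb_enum (I : finType) (g : I -> V) v :
  lincomb g v -> lincomb (fun k : 'I_#|I| => g (enum_val k)) v.
Proof.
apply: lincomb_min => [|i]; first exact: lincomb_submodule.
by rewrite -[i]enum_rankK; apply: (lincomb_gen (fun k => g (enum_val k))).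
Qed.

Lemma fin_genP :
  fin_gen V <-> exists (I : finType) (g : I -> V), forall v, lincomb g v.
Proof.
split=> [[n [g gP]]|[I [g gP]]]; first by exists 'I_n, g.
by exists #|I|, (fun i => g (enum_val i)) => v; apply/lincomb_enum/gP.
Qed.

(** The induction strips the last generator: the coefficients of that generator
    which occur in [S] form an ideal, and correcting by lifts of finitely many
    generators of this ideal leaves elements of [S] spanned by the others. *)
Lemma noetherian_submodule (S : V -> Prop) (I : finType) (g : I -> V) :
  noetherian R -> submodule S -> (forall v, S v -> lincomb g v) ->
  exists (J : finType) (h : J -> V),
    (forall j, S (h j)) /\ (forall v, S v -> lincomb h v).
Proof.
move=> noethR subS Sg.
have {}Sg v : S v -> lincomb (fun k : 'I_#|I| => g (enum_val k)) v.
  by move/Sg/lincomb_enum.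
move: #|I| (fun k => g (enum_val k)) Sg => n {}g.
elim: n => [|n IHn] in g S subS * => Sg.
  exists 'I_0, g; split=> [[]//|]; exact: Sg.
have [S0 Sl] := subS.
pose g' (i : 'I_n) := g (widen_ord (leqnSn n) i).
have [g'0 g'l] := lincomb_submodule g'.
pose J r := exists2 s, S s & lincomb g' (s - r *: g ord_max).
have idJ : is_ideal J.
  split=> [|a x y [s Ss sx] [t St ty]].
    by exists 0; rewrite // scale0r subrr.
  exists (a *: s + t); first exact: Sl.
  by rewrite scalerDl -scalerA opprD addrACA -scalerBr; apply: g'l.
have [m [r [Jr rP]]] := noethR J idJ.
have [s sP] := choice (fun i => let: ex_intro2 s Ss sr := Jr i in
  ex_intro (fun s => S s /\ lincomb g' (s - r i *: g ord_max)) s (conj Ss sr)).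
pose S' v := S v /\ lincomb g' v.
have subS' : submodule S'.
  by split=> [|a x y [Sx gx] [Sy gy]]; split; [..|exact: Sl|exact: g'l].
have [K [h [Sh hP]]] := IHn g' S' subS' (fun v => @proj2 _ _).
exists ('I_m + K)%type, (fun k => match k with inl i => s i | inr j => h j end).
split=> [[i|j]|v Sv]; [by have [] := sP i|by have [] := Sh j|].
have [a av] := Sg v Sv.
have /rP[b ab] : J (a ord_max).
  exists v => //; rewrite {1}av big_ord_recr /= addrK.
  by exists (fun i => a (widen_ord (leqnSn n) i)).
pose w := v - \sum_i b i *: s i.
have /hP[c wc] : S' w.
  split.
    rewrite /w addrC -scaleN1r; apply: Sl => //.
    by apply: submodule_sum => // i; have [] := sP i.
  (* [s i] agrees with [r i *: g ord_max] modulo the other generators, and the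
     [r i] combine to the last coefficient of [v], which therefore cancels. *)
  have ->: w = -1 *: (\sum_i b i *: (s i - r i *: g ord_max))
               + (v - a ord_max *: g ord_max).
    rewrite scaleN1r ab scaler_suml -sumrN.
    under [in RHS]eq_bigr => i _ do rewrite scalerBr scalerA opprB.
    by rewrite big_split /= sumrN [RHS]addrC [RHS]addrA subrK.
  apply: g'l.
    by apply: submodule_sum => [|i]; [exact: lincomb_submodule | case: (sP i)].
  rewrite {1}av big_ord_recr /= addrK.
  by exists (fun i => a (widen_ord (leqnSn n) i)).
exists (fun k => match k with inl i => b i | inr j => c j end).
by rewrite big_sumType /= -wc addrC subrK.
Qed.

End Span.

Lemma fin_gen_inj (R : comPzRingType) (U V : lmodType R) (f : {linear U -> V}) :
  noetherian R -> injective f -> fin_gen V -> fin_gen U.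
Proof.
move=> noethR injf /fin_genP[I [g gP]].
pose S v := exists u, v = f u.
have subS : submodule S.
  split=> [|a _ _ [x ->] [y ->]]; first by exists 0; rewrite linear0.
  by exists (a *: x + y); rewrite linearP.
have [J [h [Sh hP]]] := noetherian_submodule noethR subS (fun v _ => gP v).
have [u uP] := choice Sh.
apply/fin_genP; exists J, u => x.
have [|a ax] := hP (f x); first by exists x.
exists a; apply: injf; rewrite ax linear_sum; apply: eq_bigr => j _.
by rewrite linearZ /= uP.
Qed.

Lemma fin_gen_ffun (R : comPzRingType) (V : lmodType R) (I : finType) :
  fin_gen V -> fin_gen {ffun I -> V}.
Proof.
move=> [n [g gP]]; apply/fin_genP.
pose h j k := [ffun i : I => if i == j then g k else 0].
exists (I * 'I_n)%type, (fun p => h p.1 p.2) => v.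
have [a aP] := choice (fun i => gP (v i)).
exists (fun p => a p.1 p.2); apply/ffunP => i.
rewrite aP sum_ffunE -(pair_bigA _ (fun j k => (a j k *: h j k) i)).
rewrite (bigD1 i) //= [X in _ + X]big1 ?addr0 => [|j ji].
  by apply: eq_bigr => k _; rewrite !ffunE eqxx.
by apply: big1 => k _; rewrite !ffunE eq_sym (negPf ji) scaler0.
Qed.

Lemma fin_gen_free (R : comPzRingType) (I : finType) :
  fin_gen {ffun I -> R^o}.
Proof.
apply: fin_gen_ffun; exists 1%N, (fun=> 1) => r; exists (fun=> r).
by rewrite big_ord1 /GRing.scale /= mulr1.
Qed.

(** A homomorphism is determined by its values on generators of [C], which embeds
    [Hom(C, M)] in a finite power of [M]. *)
Lemma fin_gen_hom (R : comPzRingType) (C M : lmodType R) :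
  noetherian R -> fin_gen C -> fin_gen M -> fin_gen (hom_mod C M).
Proof.
move=> noethR [n [g gP]] Mfg.
pose r (f : hom_mod C M) := [ffun i : 'I_n => f (g i)].
have r_lin : linear r by move=> a f h; apply/ffunP => i; rewrite !ffunE.
apply: (@fin_gen_inj _ _ _ (linear_of r_lin)) => // [f h /ffunP fh|]; last first.
  exact: fin_gen_ffun.
apply: linear_ext => x; have [a ->] := gP x; rewrite !linear_sum.
by apply: eq_bigr => i _; have:= fh i; rewrite !ffunE !linearZ /= => ->.
Qed.

(** * Tensor products: extensionality and right exactness *)

Section TensorTheory.
Variable R : comPzRingType.
Implicit Types M N P F A B D : lmodType R.

Definition tensorL M N (n : N) : {linear M -> tens M N} :=
  linear_of ((@tensor_bilin R M N).1 n).
Definition tensorR M N (m : M) : {linear N -> tens M N} :=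
  linear_of ((@tensor_bilin R M N).2 m).

Lemma tensor_gen M N (S : tens M N -> Prop) :
  submodule S -> (forall m n, S (tensor m n)) -> forall t, S t.
Proof.
move=> [S0 Sl] Sg; elim/tens_ind=> s; rewrite tens_clE.
elim/big_ind: _ => // x y Sx Sy; rewrite -[x]scale1r; exact: Sl.
Qed.

Lemma tens_ext M N P (f g : {linear tens M N -> P}) :
  (forall m n, f (tensor m n) = g (tensor m n)) -> f =1 g.
Proof.
move=> fg; apply: tensor_gen => //; split=> [|a x y fx fy].
  by rewrite !linear0.
by rewrite !linearP fx fy.
Qed.

Lemma tens_id M N (f : {linear tens M N -> tens M N}) :
  (forall m n, f (tensor m n) = tensor m n) -> forall t, f t = t.
Proof. exact: (@tens_ext _ _ _ f idfun). Qed.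

Lemma tens_eq0 M N P (f : {linear tens M N -> P}) :
  (forall m n, f (tensor m n) = 0) -> forall t, f t = 0.
Proof. exact: (@tens_ext _ _ _ f \0). Qed.

Lemma tens_map_comp M1 M2 M3 N1 N2 N3 (f : {linear M1 -> M2})
    (f' : {linear M2 -> M3}) (g : {linear N1 -> N2}) (g' : {linear N2 -> N3}) t :
  tens_map f' g' (tens_map f g t) = tens_map (f' \o f) (g' \o g) t.
Proof.
apply: (@tens_ext _ _ _ (tens_map f' g' \o tens_map f g)) => m n.
by rewrite -[LHS]/(tens_map f' g' (tens_map f g _)) !tens_mapE.
Qed.

Lemma fin_gen_tens M N : fin_gen M -> fin_gen N -> fin_gen (tens M N).
Proof.
move=> [k [g gP]] [l [h hP]]; apply/fin_genP.
exists ('I_k * 'I_l)%type, (fun p => tensor (g p.1) (h p.2)).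
apply: tensor_gen => [|m n]; first exact: lincomb_submodule.
have [a ->] := gP m; have [b ->] := hP n.
exists (fun p => a p.1 * b p.2).
rewrite -(pair_bigA _ (fun i j => (a i * b j) *: tensor (g i) (h j))) /=.
rewrite -[tensor _ _]/(tensorL _ _ _) linear_sum; apply: eq_bigr => i _.
rewrite linearZ /= -[tensor _ _]/(tensorR _ _ _) linear_sum scaler_sumr.
by apply: eq_bigr => j _; rewrite linearZ /= scalerA.
Qed.

Lemma surj_factor A B D (p : {linear A -> B}) (f : {linear A -> D}) :
  surj p -> (forall a, p a = 0 -> f a = 0) ->
  exists h : {linear B -> D}, forall a, h (p a) = f a.
Proof.
move=> surjp pf; have [s sK] := choice surjp.
have f_eq a a' : p a = p a' -> f a = f a'.
  move=> paa'; apply/eqP; rewrite -subr_eq0 -linearB; apply/eqP/pf.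
  by rewrite linearB paa' subrr.
have h_lin : linear (fun b => f (s b)).
  by move=> a x y; rewrite -linearP; apply: f_eq; rewrite linearP !sK.
by exists (linear_of h_lin) => a; apply: f_eq; rewrite sK.
Qed.

Section Cokernel.
Variables (A B : lmodType R) (f : {linear A -> B}).

Definition im_pred : {pred B} := [pred b | `[< exists a, f a = b >]].

Fact im_pred_submod : subsemimod_closed im_pred.
Proof.
split; first split.
- by rewrite inE; apply/asboolP; exists 0; rewrite linear0.
- move=> x y; rewrite !inE => /asboolP[u <-] /asboolP[v <-].
  by apply/asboolP; exists (u + v); rewrite linearD.
move=> a x; rewrite !inE => /asboolP[u <-].
by apply/asboolP; exists (a *: u); rewrite linearZ.
Qed.
HB.instance Definition _ :=
  GRing.isSubmodClosed.Build R B im_pred im_pred_submod.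

Definition coker : lmodType R := quot_mod im_pred.

Fact coker_cl_linear : linear (quot_cl im_pred : B -> coker).
Proof. by move=> a x y; rewrite quot_clD -qscaleE. Qed.
Definition coker_cl : {linear B -> coker} := linear_of coker_cl_linear.

Lemma coker_clP x y : coker_cl x = coker_cl y <-> exists a, f a = x - y.
Proof.
by split=> [/quot_clP/asboolP//|?]; apply/quot_clP; rewrite inE; apply/asboolP.
Qed.

Lemma coker_surj : surj coker_cl.
Proof. by move=> y; exists (repr y); exact: quot_clK. Qed.

End Cokernel.

Lemma tens_map_surj F A B (p : {linear A -> B}) :
  surj p -> surj (tens_map (idfun : {linear F -> F}) p).
Proof.
move=> surjp; apply: tensor_gen => [|x b].
  split=> [|a _ _ [x <-] [y <-]]; first by exists 0; rewrite linear0.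
  by exists (a *: x + y); rewrite linearP.
by have [a <-] := surjp b; exists (tensor x a); rewrite tens_mapE.
Qed.

(** The cokernel of [F (x) A -> F (x) B] receives a bilinear map from [F * D],
    sending [(x, d)] to the class of [x (x) b] for any [b] over [d]; the induced
    map on [F (x) D] recovers the class of [t] from its image, which is [0]. *)
Lemma tens_right_exact F A B D (f : {linear A -> B}) (p : {linear B -> D}) :
  surj p -> (forall b, p b = 0 -> exists a, f a = b) ->
  forall t, tens_map (idfun : {linear F -> F}) p t = 0 ->
  exists s, tens_map (idfun : {linear F -> F}) f s = t.
Proof.
move=> surjp ex; set Ff := tens_map _ f; set Fp := tens_map _ p.
have [s sK] := choice surjp.
have cl_eq x b b' : p b = p b' ->
    coker_cl Ff (tensor x b) = coker_cl Ff (tensor x b').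
  move=> pbb'; apply/coker_clP.
  have [|a fa] := ex (b - b'); first by rewrite linearB pbb' subrr.
  exists (tensor x a); rewrite /Ff tens_mapE fa.
  by rewrite -[tensor _ _]/(tensorR _ _ _) linearB.
pose b x d := coker_cl Ff (tensor x (s d)).
have b_bilin : bilin b.
  split=> [d a x y|x a d d']; rewrite /b.
    rewrite -linearP.
    exact: (congr1 (coker_cl Ff) (linearP (tensorL F (s d)) a x y)).
  rewrite -linearP -[X in _ = coker_cl _ X](linearP (tensorR B x)).
  by apply: cl_eq; rewrite linearP !sK.
move=> t pt; have: coker_cl Ff t = coker_cl Ff 0.
  rewrite linear0 -(linear0 (tens_lift b_bilin)) -pt; symmetry.
  apply: (@tens_ext _ _ _ (tens_lift b_bilin \o Fp)) => x y.
  rewrite -[LHS]/(tens_lift b_bilin (Fp _)).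
  by rewrite /Fp tens_mapE tens_liftE; apply: cl_eq; rewrite sK.
by move/coker_clP; rewrite subr0.
Qed.

(** * Flat modules *)

(** The map [g] factors as the projection of [B] on the cokernel of [f] followed
    by an injection: flatness handles the injection, right exactness the
    projection. *)
Lemma flat_exact F A B D (f : {linear A -> B}) (g : {linear B -> D}) :
  flat F -> (forall a, g (f a) = 0) -> (forall b, g b = 0 -> exists a, f a = b) ->
  forall t, tens_map (idfun : {linear F -> F}) g t = 0 ->
  exists s, tens_map (idfun : {linear F -> F}) f s = t.
Proof.
move=> flatF gf ex t gt.
have cl0 b : coker_cl f b = 0 <-> exists a, f a = b.
  by rewrite -(linear0 (coker_cl f)) coker_clP subr0.
have [|h hE] := surj_factor (f := g) (@coker_surj _ _ f).
  by move=> b /cl0[a <-].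
have h_inj : injective h.
  move=> x y; have [x' <-] := coker_surj x; have [y' <-] := coker_surj y.
  rewrite !hE => gxy; apply/coker_clP/ex.
  by rewrite linearB gxy subrr.
apply: (@tens_right_exact _ _ _ _ f (coker_cl f)) => [|b|].
- exact: coker_surj.
- by move/cl0.
have inj := flatF _ _ _ h_inj.
apply: inj; rewrite linear0 -{}gt tens_map_comp.
by apply: tens_ext => x y; rewrite !tens_mapE /= hE.
Qed.

Lemma flat_iso F F' (f : {linear F -> F'}) : bijective f -> flat F -> flat F'.
Proof.
move=> [f' fK f'K] flatF A B g injg s t.
pose f'L := linear_of (can2_linear fK f'K).
have f'g u : tens_map f'L idfun (tens_map idfun g u) =
             tens_map idfun g (tens_map f'L idfun u).
  by rewrite !tens_map_comp; apply: tens_ext => x y; rewrite !tens_mapE.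
have ff' u : tens_map f idfun (tens_map f'L idfun u) = u :> tens F' A.
  rewrite tens_map_comp; apply: tens_id => x y.
  by rewrite tens_mapE /= f'K.
move=> /(congr1 (tens_map f'L idfun)); rewrite !f'g => /flatF-/(_ injg).
by move/(congr1 (tens_map f idfun)); rewrite !ff'.
Qed.

End TensorTheory.

(** * Projective modules are flat *)

Section FreeModule.
Variables (R : comPzRingType) (T : choiceType).

(** The free module on [T] is realized as the finitely supported functions. *)
Definition fin_supp : {pred T -> R^o} :=
  [pred f | `[< exists s : seq T, forall x, x \notin s -> f x = 0 >]].

Fact fin_supp_submod : subsemimod_closed fin_supp.
Proof.
split; first split.
- by rewrite inE; apply/asboolP; exists [::].
- move=> f g; rewrite !inE => /asboolP[s sP] /asboolP[t tP]; apply/asboolP.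
  exists (s ++ t) => x; rewrite mem_cat => /norP[xs xt].
  by rewrite -[LHS]/(f x + g x) sP // tP // addr0.
move=> a f; rewrite !inE => /asboolP[s sP]; apply/asboolP; exists s => x xs.
by rewrite -[LHS]/(a * f x) sP // mulr0.
Qed.
HB.instance Definition _ :=
  GRing.isSubmodClosed.Build R (T -> R^o) fin_supp fin_supp_submod.

Definition free_mod := {f : T -> R^o | fin_supp f}.
HB.instance Definition _ := SubChoice.on free_mod.
HB.instance Definition _ := [SubChoice_isSubLmodule of free_mod by <:].

Definition supported (s : seq T) (f : free_mod) : Prop :=
  uniq s /\ forall x, x \notin s -> val f x = 0.

Lemma support_exists f : exists s, supported s f.
Proof.
have /asboolP[s sP] := valP f; exists (undup s); split; first exact: undup_uniq.
by move=> x; rewrite mem_undup; apply: sP.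
Qed.

Lemma supported_sub s t f :
  supported s f -> uniq t -> {subset s <= t} -> supported t f.
Proof. by move=> [_ sf] ut st; split=> // x /(contra (@st x))/sf. Qed.

Variables (P : lmodType R) (e : T -> P).

(** The sum does not depend on the list enumerating the support, which is what
    makes [free_lift] linear. *)
Lemma supported_sum s t f : supported s f -> supported t f ->
  \sum_(x <- s) val f x *: e x = \sum_(x <- t) val f x *: e x.
Proof.
have sub r u : supported r f -> uniq u -> {subset r <= u} ->
    \sum_(x <- u) val f x *: e x = \sum_(x <- r) val f x *: e x.
  move=> [ur rf] uu ru; rewrite (bigID (mem r)) /= [X in _ + X]big1 ?addr0.
    rewrite -big_filter; apply: perm_big; apply: uniq_perm => //.
      exact: filter_uniq.
    by move=> x; rewrite mem_filter; case: (boolP (x \in r)) => // /ru ->.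
  by move=> x /rf ->; rewrite scale0r.
move=> sf tf; rewrite -(sub s (undup (s ++ t))) ?undup_uniq //.
  by rewrite (sub t) ?undup_uniq // => x; rewrite mem_undup mem_cat orbC => ->.
by move=> x; rewrite mem_undup mem_cat => ->.
Qed.

Definition free_lift (f : free_mod) : P :=
  \sum_(x <- sval (cid (support_exists f))) val f x *: e x.

Lemma free_liftE s f :
  supported s f -> free_lift f = \sum_(x <- s) val f x *: e x.
Proof. by apply: supported_sum; case: cid. Qed.

Fact free_lift_linear : linear free_lift.
Proof.
move=> a f g; have [s sf] := support_exists f; have [t tg] := support_exists g.
have uu := undup_uniq (s ++ t); set u := undup _ in uu.
have {}sf : supported u f.
  by apply: supported_sub sf _ _ => // x; rewrite mem_undup mem_cat => ->.
have {}tg : supported u g.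
  by apply: supported_sub tg _ _ => // x; rewrite mem_undup mem_cat orbC => ->.
have E x : val (a *: f + g) x = a * val f x + val g x by rewrite linearP.
rewrite (free_liftE sf) (free_liftE tg) (@free_liftE u); last first.
  split=> // x xu; rewrite E.
  by rewrite (proj2 sf) // (proj2 tg) // mulr0 addr0.
rewrite scaler_sumr -big_split; apply: eq_bigr => x _.
by rewrite E scalerDl scalerA.
Qed.
HB.instance Definition _ :=
  GRing.isLinear.Build R free_mod P _ free_lift free_lift_linear.

Lemma free_lift_gen x : exists f, free_lift f = e x.
Proof.
pose d : T -> R^o := fun y => (y == x)%:R.
have d_supp : fin_supp d.
  by rewrite /fin_supp inE; apply/asboolP; exists [:: x] => y;
    rewrite inE /d => /negPf->.
exists (Sub d d_supp); rewrite (@free_liftE [:: x]) ?big_seq1.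
  by rewrite SubK /d eqxx scale1r.
by split=> // y; rewrite inE SubK /d => /negPf->.
Qed.

End FreeModule.

Section Flat.
Variable R : comPzRingType.
Implicit Types P F A B : lmodType R.

(** A section of the free cover of [P] on all its elements. The finite expansion
    of [y] is allowed to run over any larger list, so that several elements can
    be expanded over a common one. *)
Lemma projective_dual_basis P : projective P ->
  exists phi : P -> {linear P -> R^o}, forall y, exists s : seq P,
    forall t, uniq t -> {subset s <= t} -> y = \sum_(x <- t) phi x y *: x.
Proof.
move=> projP.
have [|h hK] := projP _ _ (@free_lift R P P id) idfun.
  by move=> x; apply: (free_lift_gen id).
have phi_lin x : linear (fun y => val (h y) x : R^o).
  by move=> a y z; rewrite !linearP.
exists (fun x => linear_of (phi_lin x)) => y.
have [s sy] := support_exists (h y); exists s => t ut st.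
exact: etrans (esym (hK y)) (free_liftE id (supported_sub sy ut st)).
Qed.

Lemma coord_bilin F A (phi : {linear F -> R^o}) :
  bilin (fun (x : F) (a : A) => (phi x : R) *: a).
Proof.
split=> [n a x y|x a n n'] /=; first by rewrite linearP scalerDl scalerA.
by rewrite scalerDr !scalerA mulrC.
Qed.
Definition coord F A (phi : {linear F -> R^o}) : {linear tens F A -> A} :=
  tens_lift (coord_bilin A phi).

Lemma coordE F A (phi : {linear F -> R^o}) x a :
  coord A phi (tensor x a) = (phi x : R) *: a.
Proof. exact: tens_liftE. Qed.

(** Expanding along a dual basis writes any tensor [t] as the sum of the
    [x (x) coord (phi x) t]. The coordinates commute with [g], so they vanish as
    soon as the image of [t] does. *)
Lemma projective_flat P : projective P -> flat P.
Proof.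
move=> /projective_dual_basis[phi phiP] A B g injg.
suff g0 t : tens_map idfun g t = 0 :> tens P B -> t = 0.
  move=> t u tu; apply/eqP; rewrite -subr_eq0; apply/eqP/g0.
  by rewrite linearB tu subrr.
have [s] : exists s : seq P, forall u, uniq u -> {subset s <= u} ->
    t = \sum_(x <- u) tensor x (coord A (phi x) t).
  move: t; apply: tensor_gen => [|y a].
    split=> [|a t u [s sP] [s' s'P]].
      by exists [::] => u _ _; rewrite big1 // => x _;
        rewrite linear0 -[tensor _ _]/(tensorR _ _ _) linear0.
    exists (s ++ s') => v uv sv.
    have /(sP v uv) tE : {subset s <= v}.
      by move=> x xs; apply: sv; rewrite mem_cat xs.
    have /(s'P v uv) uE : {subset s' <= v}.
      by move=> x xs; apply: sv; rewrite mem_cat xs orbT.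
    rewrite {1}tE {1}uE scaler_sumr -big_split; apply: eq_bigr => x _.
    rewrite (linearP (coord A (phi x))).
    exact/esym/(linearP (tensorR A x)).
  have [s sP] := phiP y; exists s => u uu su.
  rewrite {1}(sP u) // -[tensor _ _]/(tensorL _ _ _) linear_sum.
  apply: eq_bigr => x _; rewrite coordE linearZ /=.
  by rewrite -[RHS]/(tensorR _ _ _) linearZ.
move=> /(_ _ (undup_uniq s)) tE gt; rewrite tE; last first.
  by move=> x; rewrite mem_undup.
apply: big1 => x _; suff ->: coord A (phi x) t = 0.
  by rewrite -[LHS]/(tensorR _ _ _) linear0.
apply: injg; rewrite linear0 -(linear0 (coord B (phi x))) -gt.
apply: (@tens_ext _ _ _ _ (g \o coord A (phi x))
  (coord B (phi x) \o tens_map idfun g)) => y a.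
rewrite -[LHS]/(g (coord _ _ _)) -[RHS]/(coord _ _ (tens_map _ _ _)).
by rewrite tens_mapE !coordE linearZ.
Qed.

End Flat.

(** * Tensoring with finite powers *)

Section FinitePowers.
Variable R : comPzRingType.
Implicit Types F A V W : lmodType R.

Fact ffun_proj_linear V (I : finType) i : linear (fun w : {ffun I -> V} => w i).
Proof. by move=> a v w; rewrite !ffunE. Qed.
Definition ffun_proj V (I : finType) i : {linear {ffun I -> V} -> V} :=
  linear_of (@ffun_proj_linear V I i).

Fact ffun_inj_linear V (I : finType) i :
  linear (fun v : V => [ffun j : I => if j == i then v else 0]).
Proof.
move=> a v w; apply/ffunP => j; rewrite !ffunE.
by case: ifP => // _; rewrite scaler0 addr0.
Qed.
Definition ffun_inj V (I : finType) i : {linear V -> {ffun I -> V}} :=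
  linear_of (@ffun_inj_linear V I i).

Lemma ffun_projE V (I : finType) i (w : {ffun I -> V}) : ffun_proj V i w = w i.
Proof. by []. Qed.

Lemma ffun_injE V (I : finType) (i j : I) (v : V) :
  ffun_inj V i v j = if j == i then v else 0.
Proof. by rewrite ffunE. Qed.

Lemma ffun_sum V (I : finType) (w : {ffun I -> V}) :
  w = \sum_i ffun_inj V i (w i).
Proof.
apply/ffunP => j; rewrite sum_ffunE (bigD1 j) //= ffun_injE eqxx.
rewrite big1 ?addr0 // => i ij; rewrite ffun_injE.
by rewrite eq_sym (negPf ij).
Qed.

Lemma tens_ffun_sum F V (I : finType) (t : tens F {ffun I -> V}) :
  t = \sum_i tens_map idfun (ffun_inj V i) (tens_map idfun (ffun_proj V i) t).
Proof.
move: t; apply: tensor_gen => [|x w].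
  split=> [|a t u {1}-> {1}->].
    by rewrite big1 // => i _; rewrite !linear0.
  rewrite scaler_sumr -big_split; apply: eq_bigr => i _.
  by rewrite !linearP.
rewrite {1}[w]ffun_sum -[tensor _ _]/(tensorR _ _ _) linear_sum.
by apply: eq_bigr => i _; rewrite !tens_mapE.
Qed.

Lemma coordR_bilin F A (psi : {linear A -> R^o}) :
  bilin (fun (x : F) (a : A) => (psi a : R) *: x).
Proof.
split=> [a b x y|x b a a'] /=; last by rewrite linearP scalerDl scalerA.
by rewrite scalerDr !scalerA mulrC.
Qed.
Definition coordR F A (psi : {linear A -> R^o}) : {linear tens F A -> F} :=
  tens_lift (coordR_bilin F psi).

Lemma coordRE F A (psi : {linear A -> R^o}) x a :
  coordR F psi (tensor x a) = (psi a : R) *: x.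
Proof. exact: tens_liftE. Qed.

Lemma tens_regular F (t : tens F R^o) :
  t = tensor (coordR F idfun t) (1 : R^o).
Proof.
move: t; apply: tensor_gen => [|x r].
  split=> [|a t u {1}-> {1}->].
    by rewrite linear0 -[RHS]/(tensorL _ _ _) linear0.
  rewrite (linearP (coordR F idfun)).
  exact/esym/(linearP (tensorL F (1 : R^o))).
rewrite coordRE -[RHS]/(tensorL _ _ _) linearZ /=.
rewrite -[X in _ *: X]/(tensorR _ x (1 : R^o)) -linearZ /=; congr tensor.
by rewrite /GRing.scale /= mulr1.
Qed.

End FinitePowers.

(** * Homomorphisms from a finitely presented module into a flat twist *)

Section HomTensor.
Variables (R : comPzRingType) (C : lmodType R).

Definition gens_map (n : nat) (g : 'I_n -> C) (a : {ffun 'I_n -> R^o}) : C :=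
  \sum_i (a i : R) *: g i.

Fact gens_map_linear n g : linear (@gens_map n g).
Proof.
move=> a b c; rewrite scaler_sumr -big_split; apply: eq_bigr => i _.
by rewrite !ffunE scalerA scalerDl.
Qed.
HB.instance Definition _ n g :=
  GRing.isLinear.Build R _ C _ (@gens_map n g) (@gens_map_linear n g).

(** Over a noetherian ring, the module of relations between finitely many
    generators is finitely generated. *)
Lemma fin_presented n (g : 'I_n -> C) : noetherian R ->
  exists m (k : 'I_m -> {ffun 'I_n -> R^o}),
    (forall j, gens_map g (k j) = 0) /\
    (forall a, gens_map g a = 0 -> lincomb k a).
Proof.
move=> noethR.
have [m [k kP]] : fin_gen (ker_mod (gens_map g)).
  exact: (fin_gen_inj (f := val) noethR val_inj (fin_gen_free R _)).
exists m, (fun j => val (k j)); split=> [j|a /eqP a0].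
  exact/eqP/(valP (k j)).
have [b ab] := kP (Sub a a0); exists b.
by rewrite -[a in LHS](SubK (ker_mod (gens_map g)) a0) ab linear_sum.
Qed.

Hypothesis homothety_bij : bijective (homothety C).

Fact mult_gens_linear n (g : 'I_n -> C) :
  linear (fun r : R^o => [ffun i => (r : R) *: g i]).
Proof.
by move=> a r s; apply/ffunP => i; rewrite !ffunE scalerDl scalerA.
Qed.
(** With [relations] below, this forms the sequence [R -> C^n -> C^m] which is
    [Hom(-, C)] applied to a finite presentation of [C], with [Hom(C, C)] replaced
    by [R]. *)
Definition mult_gens n (g : 'I_n -> C) : {linear R^o -> {ffun 'I_n -> C}} :=
  linear_of (mult_gens_linear g).

Fact relations_linear n m (k : 'I_m -> {ffun 'I_n -> R^o}) :
  linear (fun w : {ffun 'I_n -> C} => [ffun j => \sum_i (k j i : R) *: w i]).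
Proof.
move=> a v w; apply/ffunP => j; rewrite !ffunE scaler_sumr -big_split.
apply: eq_bigr => i _.
by rewrite !ffunE scalerDr !scalerA [_ * a]mulrC.
Qed.
Definition relations n m (k : 'I_m -> {ffun 'I_n -> R^o}) :
    {linear {ffun 'I_n -> C} -> {ffun 'I_m -> C}} :=
  linear_of (relations_linear k).

Section Presentation.
Variables (n m : nat) (g : 'I_n -> C) (k : 'I_m -> {ffun 'I_n -> R^o}).
Hypothesis gP : forall c, lincomb g c.
Hypothesis gk : forall j, gens_map g (k j) = 0.
Hypothesis kP : forall a, gens_map g a = 0 -> lincomb k a.

Lemma relations_mult_gens r : relations k (mult_gens g r) = 0.
Proof.
apply/ffunP => j; rewrite !ffunE.
under eq_bigr => i _ do rewrite ffunE scalerA mulrC -scalerA.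
by rewrite -scaler_sumr -/(gens_map g (k j)) gk scaler0.
Qed.

Lemma mult_gens_inj : injective (mult_gens g).
Proof.
move=> r s /ffunP rs; have [h hK _] := homothety_bij.
rewrite -[r]hK -[s]hK; congr h; apply: linear_ext => c /=.
have [a ->] := gP c; rewrite !scaler_sumr; apply: eq_bigr => i _.
by have:= rs i; rewrite !ffunE !scalerA ![_ * a i]mulrC -!scalerA => ->.
Qed.

(** A family of elements of [C] subject to the relations between the generators
    is an endomorphism of [C], and those are homotheties. *)
Lemma relations_exact w : relations k w = 0 -> exists r, mult_gens g r = w.
Proof.
move=> /ffunP kw.
pose f (a : {ffun 'I_n -> R^o}) := \sum_i (a i : R) *: w i.
have f_lin : linear f.
  move=> a b c; rewrite scaler_sumr -big_split; apply: eq_bigr => i _.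
  by rewrite !ffunE scalerA scalerDl.
have g_surj : surj (gens_map g).
  move=> c; have [a ->] := gP c; exists [ffun i => a i].
  by apply: eq_bigr => i _; rewrite ffunE.
have [|h hE] := surj_factor (f := linear_of f_lin) g_surj.
  move=> a /kP; apply: (lincomb_min (S := fun a => linear_of f_lin a = 0)) => [|j].
    split=> [|b x y x0 y0]; first by rewrite linear0.
    by rewrite linearP x0 y0 scaler0 addr0.
  by have:= kw j; rewrite !ffunE.
have [h' _ h'K] := homothety_bij.
have hh : homothety C (h' h) = h by apply: h'K.
exists (h' h); apply/ffunP => i.
have -> : w i = h (g i).
  rewrite -[g i](_ : gens_map g [ffun j => (j == i)%:R] = _) ?hE /=.
    rewrite /f (bigD1 i) //= ffunE eqxx scale1r big1 ?addr0 // => j /negPf ji.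
    by rewrite ffunE ji scale0r.
  rewrite /gens_map (bigD1 i) //= ffunE eqxx scale1r big1 ?addr0 // => j /negPf ji.
  by rewrite ffunE ji scale0r.
by rewrite -[in RHS]hh ffunE.
Qed.

End Presentation.

Variables (F : lmodType R).
Hypotheses (noethR : noetherian R) (Cfg : fin_gen C) (flatF : flat F).

Lemma tens_mult_gens n (g : 'I_n -> C) (x : F) :
  tens_map idfun (mult_gens g) (tensor x (1 : R^o)) = tensor x [ffun i => g i].
Proof.
rewrite tens_mapE; congr tensor; apply/ffunP => i.
by rewrite !ffunE scale1r.
Qed.

(** The map [R -> C^n] given by the generators is injective, and stays so after
    tensoring with [F]. *)
Lemma hom_tens_inj (x : F) : (forall c : C, tensor x c = 0) -> x = 0.
Proof.
move=> x0; have [n [g gP]] := Cfg.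
have inj := flatF (mult_gens_inj gP).
have /(congr1 (coordR F idfun)): tensor x (1 : R^o) = 0.
  apply: inj; rewrite tens_mult_gens linear0 [LHS]tens_ffun_sum big1 // => i _.
  by rewrite tens_mapE ffun_projE x0 linear0.
by rewrite coordRE linear0 scale1r.
Qed.

(** The values of [u] on the generators of [C] assemble to an element of
    [F (x) C^n] which the relations kill. By flatness, the exact sequence
    [R -> C^n -> C^m] remains exact after tensoring with [F], so this element
    comes from [F (x) R = F]. *)
Lemma hom_tens_surj (u : {linear C -> tens F C}) :
  exists x, forall c, u c = tensor x c.
Proof.
have [n [g gP]] := Cfg; have [m [k [gk kP]]] := fin_presented g noethR.
have [t tE] : exists t : tens F {ffun 'I_n -> C},
    forall i, tens_map idfun (ffun_proj C i) t = u (g i).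
  exists (\sum_i tens_map idfun (ffun_inj _ i) (u (g i))) => i.
  rewrite linear_sum (bigD1 i) // big1 => [|j ji].
    rewrite [LHS]addr0 tens_map_comp; apply: tens_id => x c.
    by rewrite tens_mapE /= ffun_injE eqxx.
  rewrite tens_map_comp; apply: tens_eq0 => x c.
  rewrite tens_mapE /= ffun_injE eq_sym (negPf ji).
  by rewrite -[LHS]/(tensorR _ _ _) linear0.
have [|s st] := flat_exact flatF (relations_mult_gens gk)
  (relations_exact gP kP) (t := t).
  rewrite [LHS]tens_ffun_sum big1 // => j _.
  rewrite [X in tens_map _ _ X](_ : _ = u (gens_map g (k j))).
    by rewrite gk !linear0.
  rewrite /gens_map [RHS]linear_sum.
  under eq_bigr => i _ do rewrite linearZ /= -tE.
  rewrite tens_map_comp.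
  move: t {tE}; apply: tensor_gen.
    split=> [|a y z]; first by rewrite linear0 big1 // => i _; rewrite linear0 scaler0.
    rewrite linearP => -> ->; rewrite scaler_sumr -big_split.
    by apply: eq_bigr => i _; rewrite linearP scalerDr !scalerA mulrC.
  move=> x w; rewrite tens_mapE -[X in tensor _ X]/(relations k w j) ffunE.
  rewrite -[LHS]/(tensorR _ _ _) [LHS]linear_sum.
  by apply: eq_bigr => i _; rewrite tens_mapE linearZ.
exists (coordR F idfun s) => c; have [a ->] := gP c.
rewrite linear_sum -[RHS]/(tensorR _ _ _) linear_sum; apply: eq_bigr => i _.
rewrite !linearZ /=; congr (_ *: _).
rewrite -tE -st [s in LHS]tens_regular tens_mult_gens tens_mapE.
by rewrite /= ffunE.
Qed.

End HomTensor.

(** * Evaluation on twisted modules *)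

Section Evaluation.
Variables (R : comPzRingType) (C : lmodType R).
Implicit Types X Y N F : lmodType R.

(** Evaluation is [h (x) (c (x) n) |-> h c (x) n]; letting [h] act on [C (x) N] as
    a whole makes this a single bilinear map instead of nested ones. *)
Fact hom_ev_bilin X N :
  bilin (fun (h : hom_mod C X) (z : tens C N) => tens_map h idfun z).
Proof.
split=> [z a h h'|h a z z']; last exact: linearP.
rewrite -[LHS]/(tens_map (a *: h + h' : hom_mod C X) idfun z).
pose ah := (a \*: tens_map h idfun) \+ tens_map h' (idfun : {linear N -> N}).
apply: (@tens_ext _ _ _ _ _ ah) => c n.
rewrite -[RHS]/(a *: tens_map h idfun _ + tens_map h' idfun _) !tens_mapE.
exact: (linearP (tensorL X n)).
Qed.
Definition hom_ev X N : {linear tens (hom_mod C X) (tens C N) -> tens X N} :=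
  tens_lift (hom_ev_bilin X N).

Lemma hom_evE X N h z : hom_ev X N (tensor h z) = tens_map h idfun z.
Proof. exact: tens_liftE. Qed.

Lemma hom_ev_natural X Y N (f : {linear X -> Y}) t :
  tens_map f idfun (hom_ev X N t) =
  hom_ev Y N
    (tens_map (hom_post f : {linear hom_mod C X -> hom_mod C Y}) idfun t).
Proof.
pose l := tens_map f idfun \o hom_ev X N.
pose f' : {linear hom_mod C X -> hom_mod C Y} := hom_post f.
pose r := hom_ev Y N \o tens_map f' idfun.
apply: (@tens_ext _ _ _ _ l r) => h z.
rewrite -[LHS]/(tens_map f idfun (hom_ev X N _)).
rewrite -[RHS]/(hom_ev Y N (tens_map _ idfun _)) tens_mapE !hom_evE.
rewrite tens_map_comp; by apply: tens_ext => c n; rewrite !tens_mapE.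
Qed.

Section Twist.
Hypotheses (homothety_bij : bijective (homothety C)).
Hypotheses (noethR : noetherian R) (Cfg : fin_gen C).
Variables (F X : lmodType R) (flatF : flat F).
Variable theta : {linear X -> tens F C}.
Variable theta' : {linear tens F C -> X}.
Hypotheses (thetaK : cancel theta theta') (theta'K : cancel theta' theta).

Definition twist_hom (x : F) : hom_mod C X := theta' \o tensorR C x.

Fact twist_hom_linear : linear twist_hom.
Proof.
move=> a x y; apply: linear_ext => c.
by rewrite -[LHS]/(theta' (tensorL F c _)) !linearP.
Qed.
HB.instance Definition _ :=
  GRing.isLinear.Build R F (hom_mod C X) _ twist_hom twist_hom_linear.

Lemma twist_homE x c : twist_hom x c = theta' (tensor x c).
Proof. by []. Qed.

Lemma twist_hom_surj (h : hom_mod C X) : exists x, twist_hom x = h.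
Proof.
have [x hx] := hom_tens_surj homothety_bij noethR Cfg flatF (theta \o h).
by exists x; apply: linear_ext => c; rewrite twist_homE -hx thetaK.
Qed.

Lemma twist_hom_inj : injective twist_hom.
Proof.
move=> x y xy; apply/eqP; rewrite -subr_eq0; apply/eqP.
apply: (hom_tens_inj homothety_bij Cfg flatF) => c.
have xy0 : twist_hom (x - y) = 0 by rewrite linearB /= xy subrr.
rewrite -[LHS]theta'K -twist_homE xy0; exact: linear0.
Qed.

Lemma twist_hom_bij : bijective twist_hom.
Proof.
have [g gK] := choice twist_hom_surj; exists g => // x.
by apply: twist_hom_inj; rewrite gK.
Qed.

Variable N : lmodType R.

Fact twist_hom_tensor_bilin (n : N) :
  bilin (fun (x : F) (c : C) => tensor (twist_hom x) (tensor c n)).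
Proof.
split=> [c a x y|x a c c'].
  rewrite linearP; exact: (linearP (tensorL _ _)).
rewrite -[tensor (_ + _) n]/(tensorL _ _ _) linearP.
exact: (linearP (tensorR _ _)).
Qed.

Fact hom_ev_inv_bilin :
  bilin (fun (x : X) (n : N) => tens_lift (twist_hom_tensor_bilin n) (theta x)).
Proof.
split=> [n a x y|x a n n']; first by rewrite !linearP.
pose L n : {linear tens F C -> _} := tens_lift (twist_hom_tensor_bilin n).
have LE m y c : L m (tensor y c) = tensor (twist_hom y) (tensor c m).
  exact: tens_liftE.
apply: (@tens_ext _ _ _ _ (L (a *: n + n')) ((a \*: L n) \+ L n')) => y c.
rewrite -[RHS]/(a *: L n (tensor y c) + L n' (tensor y c)) !LE.
rewrite -[tensor c _]/(tensorR _ _ _) linearP.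
exact: (linearP (tensorR _ _)).
Qed.

(** Every homomorphism from [C] to [X] is of the form [twist_hom x]; on such
    homomorphisms the inverse of evaluation is visible, as it sends
    [theta' (x (x) c) (x) n] to [twist_hom x (x) (c (x) n)]. *)
Lemma hom_ev_bij : bijective (hom_ev X N).
Proof.
exists (tens_lift hom_ev_inv_bilin).
  apply: (@tens_ext _ _ _ _ (tens_lift hom_ev_inv_bilin \o hom_ev X N) idfun) => h z.
  rewrite -[LHS]/(tens_lift hom_ev_inv_bilin (hom_ev X N _)) hom_evE.
  have [x <-] := twist_hom_surj h.
  move: z; apply: (@tens_ext _ _ _ _
    (tens_lift hom_ev_inv_bilin \o tens_map (twist_hom x) idfun)
    (tensorR _ (twist_hom x))) => c n.
  rewrite -[LHS]/(tens_lift hom_ev_inv_bilin (tens_map (twist_hom x) idfun _)).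
  by rewrite tens_mapE tens_liftE twist_homE theta'K tens_liftE.
apply: (@tens_ext _ _ _ _ (hom_ev X N \o tens_lift hom_ev_inv_bilin) idfun) => x n.
rewrite -[LHS]/(hom_ev X N (tens_lift hom_ev_inv_bilin _)) tens_liftE.
rewrite -[x in RHS]thetaK; move: (theta x).
apply: (@tens_ext _ _ _ _ (hom_ev X N \o tens_lift (twist_hom_tensor_bilin n))
  (tensorL _ n \o theta')) => y c.
rewrite -[LHS]/(hom_ev X N (tens_lift (twist_hom_tensor_bilin n) _)).
by rewrite tens_liftE hom_evE tens_mapE.
Qed.

End Twist.

Lemma in_FC_hom X : semidualizing C -> noetherian R -> in_FC C X ->
  flat (hom_mod C X) /\ forall N, bijective (hom_ev X N).
Proof.
move=> [Cfg Cbij _] noethR [F [flatF [theta [theta' thetaK theta'K]]]].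
pose th' := linear_of (can2_linear thetaK theta'K).
split=> [|N].
  have bij := twist_hom_bij (theta' := th') Cbij noethR Cfg flatF thetaK theta'K.
  exact: (@flat_iso R F (hom_mod C X) _ bij flatF).
exact: (hom_ev_bij (theta' := th') Cbij noethR Cfg flatF thetaK theta'K).
Qed.

End Evaluation.

(** * Finitely generated homology *)

Section FgHomology.
Variable R : comPzRingType.
Implicit Types U V W : lmodType R.

(** Finite generation of the homology, stated with cycles and boundaries in the
    middle module instead of classes in a quotient of a submodule. *)
Definition fg_homology U V W (f : {linear U -> V}) (g : {linear V -> W}) :
    Prop :=
  exists (I : finType) (z : I -> V), (forall i, g (z i) = 0) /\
    (forall v, g v = 0 -> exists u, lincomb z (v - f u)).

Lemma fin_gen_homology U V W (f : {linear U -> V}) (g : {linear V -> W}) :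
  fg_homology f g -> fin_gen (homology f g).
Proof.
move=> [I [z [gz zP]]]; apply/fin_genP.
have kz i : in_ker g (z i) by apply/eqP.
pose z' i : ker_mod g := Sub (z i) (kz i).
pose imf := @in_im R U V W f g.
exists I, (fun i => quot_cl imf (z' i)) => h.
rewrite -[h]quot_clK -/imf; set k := repr h.
have /eqP/zP[u [a ua]] := valP k; exists a.
have -> : \sum_i a i *: quot_cl imf (z' i) =
          quot_cl imf (\sum_i a i *: z' i).
  elim/big_rec2: _ => [|i y _ _ ->].
    by apply: (addIr (quot_cl imf 0)); rewrite -quot_clD !add0r.
  by rewrite quot_clD -qscaleE.
apply/quot_clP; rewrite inE; apply/asboolP; exists u.
rewrite linearB linear_sum /=.
by rewrite -ua opprB addrC subrK.
Qed.

(** As [B] is exact in degree [n+1], the connecting map embeds [H_(n+1)(D)] in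
    [H_n(A)]. Instead of the map itself, consider the submodule [S] of the cycles [w] of [A], within the span of
    chosen generators of [H_n(A)], whose image in [B] is a boundary. Finitely many
    generators of [S] suffice, and the elements of [B] bounding them project to
    generators of [H_(n+1)(D)]. *)
Lemma fg_homology_connecting (A B D : complex R)
    (i : forall n, {linear A n -> B n}) (p : forall n, {linear B n -> D n}) n :
  noetherian R ->
  (forall n x, cx_d B n (i n.+1 x) = i n (cx_d A n x)) ->
  (forall n x, cx_d D n (p n.+1 x) = p n (cx_d B n x)) ->
  (forall n, injective (i n)) -> (forall n, surj (p n)) ->
  (forall n x, p n (i n x) = 0) ->
  (forall n b, p n b = 0 -> exists a, i n a = b) ->
  (forall b, cx_d B n b = 0 -> exists b', cx_d B n.+1 b' = b) ->
  fg_homology (cx_d A n) (cx_out A n) ->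
  fg_homology (cx_d D n.+1) (cx_out D n.+1).
Proof.
move=> noethR di dp inji surjp pi exi exB [I [z [zc zP]]].
pose S w := lincomb z w /\ exists y, cx_d B n y = i n w.
have subS : submodule S.
  split=> [|a x x' [zx [y yx]] [zx' [y' yx']]].
    by split; [have [] := lincomb_submodule z | exists 0; rewrite !linear0].
  split; first by have [_] := lincomb_submodule z; apply.
  by exists (a *: y + y'); rewrite !linearP yx yx'.
have [J [w [Sw wP]]] := noetherian_submodule noethR subS (fun _ => @proj1 _ _).
have [y yE] := choice (fun j => proj2 (Sw j)).
exists J, (fun j => p n.+1 (y j)); split=> [j|v /= dv].
  by rewrite /= dp yE pi.
have [b pb] := surjp _ v.
have [|a ab] := exi n (cx_d B n b); first by rewrite -dp pb.
have /zP[u zu] : cx_out A n a = 0.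
  have outA m x : i m.-1 (cx_out A m x) = cx_out B m (i m x).
    by case: m x => [|m] x /=; [exact: linear0 | rewrite di].
  apply: inji; rewrite outA ab linear0.
  by case: (n) b {pb ab} => [|m] b //=; exact: cx_dd.
(* Modifying the lift [b] of [v] by [i u] brings [a] into [S]. *)
have /wP[c cw] : S (a - cx_d A n u).
  by split=> //; exists (b - i n.+1 u); rewrite !linearB ab di.
have [|b' b'E] := exB (b - i n.+1 u - \sum_j c j *: y j).
  rewrite !linearB -ab di -linearB cw (linear_sum (i n)).
  rewrite (linear_sum (cx_d B n)) -sumrB big1 // => j _.
  by rewrite (linearZ_LR (cx_d B n)) (linearZ_LR (i n)) yE subrr.
exists (p n.+2 b'); exists c.
rewrite dp b'E 2!(linearB (p n.+1)) pi subr0 pb subKr linear_sum.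
by apply: eq_bigr => j _; rewrite linearZ.
Qed.

Lemma fg_homology_transfer (X Y : complex R)
    (f : forall n, {linear X n -> Y n}) n :
  (forall n x, cx_d Y n (f n.+1 x) = f n (cx_d X n x)) ->
  (forall n, bijective (f n)) ->
  fg_homology (cx_d X n) (cx_out X n) -> fg_homology (cx_d Y n) (cx_out Y n).
Proof.
move=> df bijf [I [z [zc zP]]].
have out x : cx_out Y n (f n x) = 0 <-> cx_out X n x = 0.
  case: n x {z zc zP} => [//|m] x; rewrite /= df.
  by split=> [|->]; [rewrite -(linear0 (f m)) => /(bij_inj (bijf m))|exact: linear0].
have [g fK gK] := bijf n.
exists I, (fun i => f n (z i)); split=> [i|v]; first exact/out.
rewrite -[v]gK => /out/zP[u [a au]]; exists (f n.+1 u); exists a.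
rewrite df -linearB au linear_sum.
by apply: eq_bigr => i _; rewrite linearZ.
Qed.

(** * Tensoring a flat resolution *)

Section FlatResolution.
Variables (F : complex R) (M : lmodType R) (e : {linear F 0 -> M}).
Hypotheses (noethR : noetherian R) (flatF : forall n, flat (F n)).
Hypotheses (Mfg : fin_gen M) (surje : surj e).
Hypothesis exe : forall x, e x = 0 -> exists y, cx_d F 0 y = x.
Hypothesis exF : forall n x, cx_d F n x = 0 -> exists y, cx_d F n.+1 y = x.

(** This homology is [M (x) N], so lifts to [F_0] of generators of [M], tensored
    with generators of [N], represent generators of it. *)
Lemma fg_homology_tens0 N : fin_gen N ->
  fg_homology (cx_d (tens_complex F N) 0) (cx_out (tens_complex F N) 0).
Proof.
move=> [k [h hP]]; have [l [g gP]] := Mfg.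
have [g' g'E] := choice (fun j => surje (g j)).
pose z (q : 'I_l * 'I_k) := tensor (g' q.1) (h q.2).
exists ('I_l * 'I_k)%type, z; split=> // v _; move: v.
have [z0 zl] := lincomb_submodule z.
apply: tensor_gen => [|x n].
  split=> [|a v v' [u zu] [u' zu']]; first by exists 0; rewrite linear0 subrr.
  exists (a *: u + u').
  by rewrite linearP opprD addrACA -scalerBr; apply: zl.
have [a ax] := gP (e x); have [b ->] := hP n.
have [|y yE] := exe (x := x - \sum_j a j *: g' j).
  rewrite linearB linear_sum ax; apply/eqP; rewrite subr_eq0; apply/eqP.
  by apply: eq_bigr => j _; rewrite linearZ /= g'E.
exists (tensor y (\sum_j b j *: h j)); exists (fun q => a q.1 * b q.2).
set hb := \sum_j b j *: h j.
rewrite -[cx_d _ _ _]/(tens_map (cx_d F 0) idfun (tensor y hb)) tens_mapE yE.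
rewrite -![tensor _ _]/(tensorL _ hb _) -linearB subKr linear_sum.
rewrite -(pair_bigA _ (fun i j => (a i * b j) *: tensor (g' i) (h j))) /=.
apply: eq_bigr => i _.
rewrite -[LHS]/(tensorL _ hb _) linearZ /=.
rewrite -[tensor _ hb]/(tensorR _ _ _) linear_sum scaler_sumr.
by apply: eq_bigr => j _; rewrite linearZ /= scalerA.
Qed.

(** Tensoring with [R^k] gives [k] copies of [F], so exactness is checked on
    coordinates. *)
Lemma tens_free_exact k n (t : tens (F n.+1) {ffun 'I_k -> R^o}) :
  tens_map (cx_d F n) idfun t = 0 ->
  exists s, tens_map (cx_d F n.+1) idfun s = t.
Proof.
move=> dt.
have coord0 j : cx_d F n (coordR _ (ffun_proj _ j) t) = 0.
  rewrite -(linear0 (coordR (F n) (ffun_proj R^o j))) -dt.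
  apply: (@tens_ext _ _ _ _ (cx_d F n \o coordR _ (ffun_proj _ j))
    (coordR _ (ffun_proj _ j) \o tens_map (cx_d F n) idfun)) => x v.
  rewrite -[LHS]/(cx_d F n (coordR _ _ _)).
  by rewrite -[RHS]/(coordR _ _ (tens_map _ _ _)) tens_mapE !coordRE linearZ.
have [y yE] := choice (fun j => exF (coord0 j)).
exists (\sum_j tensor (y j) (ffun_inj R^o j 1)).
rewrite linear_sum [RHS]tens_ffun_sum; apply: eq_bigr => j _.
rewrite tens_mapE yE [X in _ = tens_map _ _ X]tens_regular tens_mapE.
congr tensor; rewrite /=.
apply: (@tens_ext _ _ _ _ (coordR _ (ffun_proj _ j))
  (coordR _ idfun \o tens_map idfun (ffun_proj _ j))) => x v.
by rewrite -[RHS]/(coordR _ _ (tens_map _ _ _)) tens_mapE !coordRE.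
Qed.

(** Dimension shifting along [0 -> K -> R^k -> N -> 0]. *)
Lemma fg_homology_tens N n : fin_gen N ->
  fg_homology (cx_d (tens_complex F N) n) (cx_out (tens_complex F N) n).
Proof.
elim: n N => [|n IHn] N Nfg; first exact: fg_homology_tens0.
have [k [g gP]] := Nfg.
pose q : {linear {ffun 'I_k -> R^o} -> N} := gens_map g.
pose K : lmodType R := ker_mod q.
pose i : {linear K -> {ffun 'I_k -> R^o}} := val.
have Kfg : fin_gen K.
  exact: (fin_gen_inj (f := i) noethR val_inj (fin_gen_free R _)).
have q_surj : surj q.
  move=> c; have [a ->] := gP c; exists [ffun j => a j].
  by apply: eq_bigr => j _; rewrite ffunE.
have qi x : q (i x) = 0 by apply/eqP/(valP x).
have exq b : q b = 0 -> exists a, i a = b.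
  by move=> /eqP qb; exists (Sub b qb); exact: SubK.
apply: (@fg_homology_connecting (tens_complex F K)
  (tens_complex F {ffun 'I_k -> R^o}) (tens_complex F N)
  (fun m => tens_map idfun i) (fun m => tens_map idfun q)) => //.
- move=> m x; rewrite -[LHS]/(tens_map (cx_d F m) idfun (tens_map idfun i x)).
  rewrite -[RHS]/(tens_map idfun i (tens_map (cx_d F m) idfun x)) !tens_map_comp.
  by apply: tens_ext => y z; rewrite !tens_mapE.
- move=> m x; rewrite -[LHS]/(tens_map (cx_d F m) idfun (tens_map idfun q x)).
  rewrite -[RHS]/(tens_map idfun q (tens_map (cx_d F m) idfun x)) !tens_map_comp.
  by apply: tens_ext => y z; rewrite !tens_mapE.
- by move=> m; apply: flatF; apply: val_inj.
- by move=> m; apply: tens_map_surj.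
- move=> m x; rewrite tens_map_comp; move: x; apply: tens_eq0 => x y.
  rewrite tens_mapE -[X in tensor _ X]/(q (i y)) qi.
  exact: (linear0 (tensorR _ _)).
- by move=> m; apply: tens_right_exact.
- by move=> b; apply: tens_free_exact.
exact: IHn.
Qed.

End FlatResolution.
End FgHomology.

(** * The twisted resolution *)

Lemma projective_regular (R : comPzRingType) : projective (R^o : lmodType R).
Proof.
move=> A B p f surjp; have [a pa] := surjp (f 1).
have mul_lin : linear (fun r : R^o => (r : R) *: a).
  by move=> r x y; rewrite scalerDl scalerA.
exists (linear_of mul_lin) => r /=; rewrite linearZ /= pa -linearZ /=.
by rewrite /GRing.scale /= mulr1.
Qed.

Lemma in_PC_self (R : comPzRingType) (C : lmodType R) : in_PC C C.
Proof.
exists R^o; split; first exact: projective_regular.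
pose scal := coord C (idfun : {linear R^o -> R^o}).
exists (tensorR C (1 : R^o)); exists scal.
  by move=> c; rewrite [LHS]coordE scale1r.
move=> t; apply: (@tens_id _ _ _ (tensorR C (1 : R^o) \o scal)) => r c.
rewrite -[LHS]/(tensorR C (1 : R^o) (scal (tensor r c))) coordE linearZ /=.
rewrite -[X in _ *: X]/(tensorL R^o c 1) -linearZ /=; congr tensor.
by rewrite /GRing.scale /= mulr1.
Qed.

Lemma in_PC_FC (R : comPzRingType) (C X : lmodType R) : in_PC C X -> in_FC C X.
Proof. by move=> [P [/projective_flat flatP isoX]]; exists P. Qed.

(** Exactness of [Hom(C, X+)] makes [Hom(C, X)] a flat resolution of [Hom(C, M)],
    and evaluation transports the homology of its tensor product with
    [C (x) N] to that of [X (x) N]. *)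
Lemma fin_gen_twisted_homology (R : comPzRingType) (C M N : lmodType R)
    (X : complex R) (e : {linear X 0 -> M}) (ed : forall x, e (cx_d X 0 x) = 0) :
  noetherian R -> semidualizing C -> fin_gen M -> fin_gen N ->
  (forall i, in_FC C (X i)) -> cx_exact (hom_complex C (augmented ed)) ->
  forall i, fin_gen (cx_homology (tens_complex X N) i).
Proof.
move=> noethR sdC Mfg Nfg memX exX i; apply: fin_gen_homology.
have Cfg := sd_fin_gen sdC.
apply: (@fg_homology_transfer _ (tens_complex (hom_complex C X) (tens C N))
  (tens_complex X N) (fun n => hom_ev C (X n) N)).
- by move=> n x; apply: (hom_ev_natural (cx_d X n)).
- by move=> n; have [_] := in_FC_hom sdC noethR (memX n); apply.
pose eC : {linear hom_complex C X 0 -> hom_mod C M} := hom_post e.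
apply: (@fg_homology_tens _ _ (hom_mod C M) eC) => //.
- by move=> n; have [] := in_FC_hom sdC noethR (memX n).
- exact: fin_gen_hom.
- by move=> h; apply: (exX 0 h).
- by move=> h; apply: (exX 1 h).
- by move=> n h; apply: (exX n.+2 h).
exact: fin_gen_tens.
Qed.

Theorem proposition3p8 (R : comPzRingType) (C M N : lmodType R) :
  noetherian R -> semidualizing C -> fin_gen M -> fin_gen N ->
  (forall (Q : proper_resolution (in_PC C) M) (i : nat),
     fin_gen (Tor_PCM Q N i)) /\
  (forall (G : proper_resolution (in_FC C) M) (i : nat),
     fin_gen (Tor_FCM G N i)).
Proof.
move=> noethR sdC Mfg Nfg; split=> [Q|G] i.
  apply: (@fin_gen_twisted_homology R C M N Q _ (@prop_augd _ _ _ Q)) => // [j|].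
    exact/in_PC_FC/(prop_mem Q).
  exact: (@prop_exact _ _ _ Q C (in_PC_self C)).
apply: (@fin_gen_twisted_homology R C M N G _ (@prop_augd _ _ _ G)) => // [j|].
  exact: (prop_mem G).
exact: (@prop_exact _ _ _ G C (in_PC_FC (in_PC_self C))).
Qed.
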